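(* Let $n$ be a strongly pseudoperfect number. If there exists a strongly pseudoperfect representation of $n$ in which the divisor pair $(1,n)$ is not omitted, then $n^k$ is strongly pseudoperfect for every positive integer $k$.
   Context: A positive integer $n$ is strongly pseudoperfect if there is a subset $S$ of the positive divisors of $n$ (with $1$ and $n$ themselves allowed) such that $d\in S$ if and only if $n/d\in S$ for every positive divisor $d$ of $n$, and $\sum_{d\in S} d = 2n$. Such a set $S$ is called a strongly pseudoperfect representation of $n$. A positive divisor of $n$ that is not in $S$ is called an omitted divisor of the representation; a divisor pair $(d,n/d)$ is omitted if $d,n/d\notin S$. *)

(* Defs.v *)
From mathcomp Require Import all_boot finmap.

Set Implicit Arguments.
Unset Strict Implicit.
Unset Printing Implicit Defensive.

(* Since S is a set, when n = d ^ 2 the self-paired divisor d counts once in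
   the sum. *)
Definition strongly_pseudoperfect_repr (n : nat) (S : {fset nat}) : Prop :=
  [/\ {subset S <= divisors n},
      forall d : nat, d \in divisors n -> (d \in S <-> n %/ d \in S)
    & \sum_(d <- S) d = 2 * n].

Definition strongly_pseudoperfect (n : nat) : Prop :=
  0 < n /\ exists S : {fset nat}, strongly_pseudoperfect_repr n S.

Definition omitted_divisor (n : nat) (S : {fset nat}) (d : nat) : bool :=
  (d \in divisors n) && (d \notin S).

Definition omitted_pair (n : nat) (S : {fset nat}) (d e : nat) : bool :=
  [&& d * e == n, omitted_divisor n S d & omitted_divisor n S e].

(* Main.v *)
Require Import Defs.
From mathcomp Require Import all_boot finmap.
From mathcomp Require Import zify.

(** With A := S \ {1, n}, whose sum is n - 1, the identity
    2 n^k = 1 + n^k + (n - 1)(1 + n + ... + n^(k-1))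
    suggests the set {1, n^k} together with the translates n^i A for i < k.
    These lie strictly between n^i and n^(i+1), so nothing is counted twice,
    and the complement of n^i a in n^k is n^(k-1-i) (n / a). *)

Definition powseq (n k : nat) (A : seq nat) : seq nat :=
  [:: 1, n ^ k & [seq n ^ i * a | i <- iota 0 k, a <- A]].

Section PowerSequence.
Variables (n : nat) (A : seq nat).
Hypotheses (n_gt1 : 1 < n) (uniqA : uniq A).
Hypothesis rangeA : {in A, forall a, 1 < a < n}.

(** The exponent is the unique i with n^i <= n^i * a < n^(i+1). The cofactor b need not lie in [A],
    so that b = 1 covers pure powers of n as well. *)
Lemma expn_mul_eq {i j a b} : a \in A -> 0 < b < n ->
  n ^ i * a = n ^ j * b -> i = j /\ a = b.
Proof.
move=> /rangeA /andP[a_gt1 a_ltn] /andP[b_gt0 b_ltn] eq_ij.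
have n_gt0 : 0 < n by exact: ltnW.
(* From n^i' <= n^i' * a' = n^j' * b' < n^(j'+1); used in both directions. *)
have le_exp i' j' a' b' : 0 < a' -> b' < n ->
    n ^ i' * a' = n ^ j' * b' -> i' <= j'.
  move=> a'_gt0 b'_ltn e; rewrite -ltnS -(ltn_exp2l _ _ n_gt1).
  apply: (@leq_ltn_trans (n ^ i' * a')); first by rewrite leq_pmulr.
  by rewrite e expnS mulnC ltn_pmul2r // expn_gt0 n_gt0.
have ij : i = j.
  apply/anti_leq/andP; split; first exact: le_exp (ltnW a_gt1) b_ltn eq_ij.
  exact: le_exp b_gt0 a_ltn (esym eq_ij).
split=> //; move/eqP: eq_ij; rewrite ij eqn_pmul2l; first by move/eqP.
by rewrite expn_gt0 n_gt0.
Qed.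

(** Positivity of k separates 1 from n^k; [expn_mul_eq] excludes every other coincidence, with 1
    read as n^0 * 1 and n^k as n^k * 1. *)
Lemma powseq_uniq k : 0 < k -> uniq (powseq n k A).
Proof.
move=> k_gt0; rewrite /powseq /= in_cons negb_or -andbA; apply/and4P; split.
- by rewrite neq_ltn -{1}(expn0 n) ltn_exp2l // k_gt0.
- apply/allpairsP=> -[[i a] /= [_ aA]]; rewrite -[1](muln1 (n ^ 0)).
  move=> /esym /(expn_mul_eq aA) [//|_ a1].
  by move/rangeA: aA; rewrite a1.
- apply/allpairsP=> -[[i a] /= [_ aA]]; rewrite -[n ^ k]muln1.
  move=> /esym /(expn_mul_eq aA) [|_ a1]; first exact: n_gt1.
  by move/rangeA: aA; rewrite a1.
- apply: allpairs_uniq; rewrite ?iota_uniq //.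
  move=> _ _ /allpairsP[[i a] /= [_ aA ->]] /allpairsP[[j b] /= [_ bA ->]] /=.
  have /andP[b_gt1 b_ltn] := rangeA _ bA.
  by move=> /(expn_mul_eq aA) [|-> ->] //; rewrite b_ltn ltnW.
Qed.

Lemma sum_powseq k : (\sum_(a <- A) a).+1 = n ->
  \sum_(d <- powseq n k A) d = 2 * n ^ k.
Proof.
move=> sumA; rewrite /powseq !big_cons big_allpairs_dep.
under eq_bigr => i _ do rewrite -big_distrr /=.
have iotaE : iota 0 k = index_iota 0 k by rewrite /index_iota subn0.
rewrite -big_distrl /= iotaE big_mkord.
have -> : \sum_(a <- A) a = n.-1 by rewrite -sumA.
(* The geometric sum times n - 1 is n^k - 1, which the leading 1 completes to a second n^k. *)
rewrite mulnC -predn_exp add1n -addnS prednK ?addnn ?mul2n //.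
by rewrite expn_gt0 ltnW.
Qed.

Hypothesis divA : {in A, forall a, a %| n}.
Hypothesis symA : {in A, forall a, n %/ a \in A}.

Lemma powseq_dvdn k d : d \in powseq n k A -> d %| n ^ k.
Proof.
rewrite !inE => /or3P[/eqP->|/eqP->|/allpairsP[[i a] /= [ik aA ->]]] //.
have lt_ik : i < k by move: ik; rewrite mem_iota.
(* As i < k, n^k = n^i * (n * n^(k-i-1)), and the spare factor n absorbs a. *)
rewrite -(subnKC lt_ik) addSnnS expnD expnS dvdn_pmul2l ?dvdn_mulr ?divA //.
by rewrite expn_gt0 ltnW.
Qed.

Lemma powseq_sym k d : d \in powseq n k A -> n ^ k %/ d \in powseq n k A.
Proof.
have nX_gt0 i : 0 < n ^ i by rewrite expn_gt0 ltnW.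
rewrite !inE => /or3P[/eqP->|/eqP->|/allpairsP[[i a] /= [ik aA ->]]].
- by rewrite divn1 eqxx orbT.
- by rewrite divnn nX_gt0.
have lt_ik : i < k by move: ik; rewrite mem_iota.
apply/or3P/Or33/allpairsP; exists (k - i.+1, n %/ a); split=> /=.
- by rewrite mem_iota ltn_subrL (leq_ltn_trans _ lt_ik).
- exact: symA.
rewrite -{1}(subnKC lt_ik) addSnnS expnD expnS divnMl //.
by rewrite mulnC muln_divA ?divA.
Qed.

End PowerSequence.

Lemma strongly_pseudoperfect_powseq n k (A : seq nat) :
  1 < n -> uniq A -> {in A, forall a, 1 < a < n} ->
  {in A, forall a, a %| n} -> {in A, forall a, n %/ a \in A} ->
  (\sum_(a <- A) a).+1 = n -> 0 < k -> strongly_pseudoperfect (n ^ k).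
Proof.
move=> n_gt1 uniqA rangeA divA symA sumA k_gt0.
have nk_gt0 : 0 < n ^ k by rewrite expn_gt0 ltnW.
split=> //; exists [fset x in powseq n k A]%fset.
have memT d : (d \in [fset x in powseq n k A]%fset) = (d \in powseq n k A).
  by rewrite !inE.
split.
- by move=> d; rewrite memT -dvdn_divisors //; apply: powseq_dvdn.
- move=> d; rewrite -dvdn_divisors // => d_dvd; rewrite !memT.
  split; first exact: powseq_sym.
  (* The converse is the same closure applied to n^k / d, whose complement is d. *)
  move=> /(powseq_sym n A n_gt1 divA symA).
  by rewrite divnA // mulKn.
(* Passing from the sequence to the finite set keeps the sum, since no entry repeats. *)
- rewrite -(sum_powseq n A n_gt1 k sumA); apply/perm_big/uniq_perm => //.
  exact: powseq_uniq.
Qed.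

Theorem theorem5 (n : nat) (hn : strongly_pseudoperfect n)
    (hS : exists S : {fset nat},
        strongly_pseudoperfect_repr n S /\ ~~ omitted_pair n S 1 n) :
  forall k : nat, 0 < k -> strongly_pseudoperfect (n ^ k).
Proof.
case: hn => n_gt0 _; case: hS => S [[subS symS sumS] keep] k k_gt0.
have dvdS d : d \in S -> d %| n by move/subS; rewrite -dvdn_divisors.
have divn1n : 1 \in divisors n by rewrite -dvdn_divisors.
have divnnn : n \in divisors n by rewrite -dvdn_divisors.
(* Being complementary, 1 and n lie in S together or not at all, so a pair that is not omitted lies
   wholly in S. *)
have S1n : (1 \in S) = (n \in S).
  by apply/idP/idP => [/(symS _ divn1n)|/(symS _ divnnn)];
    rewrite ?divn1 ?divnn ?n_gt0.
have nS : n \in S.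
  move: keep; rewrite /omitted_pair /omitted_divisor mul1n eqxx divn1n divnnn.
  by rewrite S1n /= andbb negbK.
have S1 : 1 \in S by rewrite S1n.
(* If n = 1, then S = {1} has sum 1 instead of 2. *)
have n_gt1 : 1 < n.
  rewrite ltn_neqAle n_gt0 andbT; apply/negP => /eqP n1.
  have S_eq1 : S = [fset 1]%fset.
    apply/fsetP => x; rewrite inE; apply/idP/eqP => [/dvdS|-> //].
    by rewrite -n1 dvdn1 => /eqP.
  by move: sumS; rewrite S_eq1 big_seq_fset1 -n1.
pose A := [seq d <- S | (d != 1) && (d != n)].
have memA a : (a \in A) = [&& a != 1, a != n & a \in S].
  by rewrite mem_filter andbA.
apply: (@strongly_pseudoperfect_powseq n k A) => //.
- exact/filter_uniq/fset_uniq.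
- move=> a; rewrite memA => /and3P[a1 an /dvdS a_dvd].
  have := dvdn_gt0 n_gt0 a_dvd; have := dvdn_leq n_gt0 a_dvd; lia.
- by move=> a; rewrite memA => /and3P[_ _ /dvdS].
- move=> a; rewrite !memA => /and3P[a1 an aS].
  have a_dvd := dvdS a aS; have eqn := divnK a_dvd.
  (* The complement avoids 1 and n: n / a = 1 would force a = n, and n / a = n would force a = 1. *)
  apply/and3P; split; last by apply/(symS _ (subS _ aS)).
    by apply: contra_neq an => q1; rewrite -eqn q1 mul1n.
  apply: contra_neq a1 => qn; move: eqn; rewrite qn => /eqP.
  by rewrite -{2}[n]muln1 eqn_pmul2l // => /eqP.
(* Removing the distinct elements 1 and n from a sum of 2n leaves n - 1. *)
- rewrite big_filter; move: sumS.
  rewrite (bigD1_seq 1) ?fset_uniq //= -big_filter.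
  rewrite (bigD1_seq n) ?filter_uniq ?fset_uniq //=.
    by rewrite big_filter_cond /=; lia.
  by rewrite mem_filter nS neq_ltn n_gt1 orbT.
Qed.
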